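(* (i) For any star $K_{1,n}$, $EC(K_{1,n})=n$. (ii) For any path $P_n$ of order $n$, $$EC(P_n)=\begin{cases} n-1, & \text{if } n\le 5,\\ 4, & \text{if } n=6,\\ 5, & \text{if } 7\le n\le 10,\\ 6, & \text{if } n\ge 11.\end{cases}$$ (iii) For any cycle $C_n$ of order $n$, $$EC(C_n)=\begin{cases} n, & \text{if } n\le 6,\\ 5, & \text{if } n=7,\\ 6, & \text{if } n\ge 8.\end{cases}$$ (iv) For any double star $S_{p,q}$, $EC(S_{p,q})=p+q+1$.
   Context: Graphs are finite and simple. Let $G=(V,E)$ be a graph. Two distinct edges are adjacent if they share an endpoint. A set $D\subseteq E$ is an edge-dominating set if every edge in $E\setminus D$ is adjacent to an edge of $D$. Two disjoint sets of edges $E_1,E_2$ form an edge coalition if neither is an edge-dominating set but $E_1\cup E_2$ is. An $ec$-partition of $G$ is a partition $\pi=\{E_1,\ldots,E_k\}$ of $E$ into nonempty sets such that every $E_i$ is either a singleton edge-dominating set, or is not an edge-dominating set but forms an edge coalition with another set $E_j$ of $\pi$. The edge coalition number $EC(G)$ is the maximum order $k$ of an $ec$-partition of $G$. The double star $S_{p,q}$, where $p\ge q\ge 0$, is the graph obtained from the two stars $K_{1,p}$ and $K_{1,q}$ by joining their centers with an edge. *)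

(* Defs.v *)
From mathcomp Require Import all_boot.

Set Implicit Arguments.
Unset Strict Implicit.
Unset Printing Implicit Defensive.

Record sgraph := SGraph {
  svertex :> finType;
  sadj : rel svertex;
  sadj_sym : symmetric sadj;
  sadj_irr : irreflexive sadj }.

(* An edge is the two-element set of its endpoints. *)
Definition edges (G : sgraph) : {set {set G}} :=
  [set [set u.1; u.2] | u : G * G & sadj u.1 u.2].

Section EdgeCoalition.

Variable G : sgraph.
Implicit Types (e f : {set G}) (D A B : {set {set G}}).

Definition edge_adj e f : bool := (e != f) && (e :&: f != set0).

Definition edge_dominating D : bool :=
  (D \subset edges G) &&
  [forall f in edges G :\: D, exists d in D, edge_adj f d].

(* That A and B consist of edges follows from A :|: B being edge-dominating. *)
Definition edge_coalition A B : bool :=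
  [&& [disjoint A & B], ~~ edge_dominating A, ~~ edge_dominating B
    & edge_dominating (A :|: B)].

(* [partition] already requires the blocks to be nonempty. *)
Definition ec_partition (P : {set {set {set G}}}) : bool :=
  partition P (edges G) &&
  [forall A in P,
     ((#|A| == 1) && edge_dominating A)
     || (~~ edge_dominating A && [exists B in P :\ A, edge_coalition A B])].

(* For an edgeless graph the only ec-partition is the empty family, so EC = 0. *)
Definition EC : nat := \max_(P : {set {set {set G}}} | ec_partition P) #|P|.

End EdgeCoalition.

Definition bip_adj m n : rel ('I_m + 'I_n) :=
  fun x y => match x, y with
             | inl _, inr _ | inr _, inl _ => true
             | _, _ => false
             end.

Lemma bip_adj_sym m n : symmetric (@bip_adj m n).
Proof. by case=> [x|x] [y|y]. Qed.

Lemma bip_adj_irr m n : irreflexive (@bip_adj m n).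
Proof. by case. Qed.

Definition complete_bipartite m n : sgraph :=
  SGraph (@bip_adj_sym m n) (@bip_adj_irr m n).

Definition star n : sgraph := complete_bipartite 1 n.

Definition star_center n : star n := inl ord0.

Definition path_adj n : rel 'I_n := fun x y => (x.+1 == y) || (y.+1 == x).

Lemma path_adj_sym n : symmetric (@path_adj n).
Proof. by move=> x y; rewrite /path_adj orbC. Qed.

Lemma path_adj_irr n : irreflexive (@path_adj n).
Proof. by move=> x; rewrite /path_adj orbb gtn_eqF. Qed.

Definition path_graph n : sgraph := SGraph (@path_adj_sym n) (@path_adj_irr n).

(* [x != y] only matters for n = 1; this is the cycle C_n when 3 <= n. *)
Definition cycle_adj n : rel 'I_n :=
  fun x y => (x != y) && ((x.+1 %% n == y) || (y.+1 %% n == x)).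

Lemma cycle_adj_sym n : symmetric (@cycle_adj n).
Proof. by move=> x y; rewrite /cycle_adj orbC eq_sym. Qed.

Lemma cycle_adj_irr n : irreflexive (@cycle_adj n).
Proof. by move=> x; rewrite /cycle_adj eqxx. Qed.

Definition cycle_graph n : sgraph :=
  SGraph (@cycle_adj_sym n) (@cycle_adj_irr n).

Definition double_star_adj p q : rel (star p + star q) :=
  fun x y => match x, y with
             | inl a, inl b => sadj a b
             | inr a, inr b => sadj a b
             | inl a, inr b | inr b, inl a =>
                 (a == star_center p) && (b == star_center q)
             end.

Lemma double_star_adj_sym p q : symmetric (@double_star_adj p q).
Proof. by case=> [x|x] [y|y] //=; apply: bip_adj_sym. Qed.

Lemma double_star_adj_irr p q : irreflexive (@double_star_adj p q).
Proof. by case=> x /=; apply: bip_adj_irr. Qed.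

Definition double_star p q : sgraph :=
  SGraph (@double_star_adj_sym p q) (@double_star_adj_irr p q).

(* Main.v *)
Require Import Defs.
From mathcomp Require Import all_boot zify.

Set Implicit Arguments.
Unset Strict Implicit.
Unset Printing Implicit Defensive.

(** An ec-partition is a colouring of the edges in which every colour class is
    a dominating singleton or is completed by another class to a dominating
    set.  Only the relation of two edges meeting matters, so that EC is read
    off any indexing of the edges together with this relation
    ([edge_model], [leq_EC], [EC_leq]).

    In stars and double stars the partition into singletons is an
    ec-partition: an edge of a star and the central edge of a double star meet
    all edges, and a leaf edge of a double star misses only the leaf edges at
    the other centre, any of which completes it ([EC_eq_card]).

    In paths and cycles an edge meets at most three edges, itself included.
    Make the colours the vertices of a graph whose edges are the dominating
    pairs.  It has no isolated vertex, and for every colour [a] an edge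
    undominated by [a] yields a vertex cover of at most three colours avoiding
    [a], namely the colours seen from that edge.  Such a graph has at most six
    vertices ([card_leq6_of_small_covers]).

    Six colours are attained in long paths and cycles.  Take a colouring ending
    in 0, 1 in which every colour lies in a dominating pair containing 0 or 1,
    and append 0, 1, 0, 1, ..., an even number of colours in the case of a
    cycle: these pairs still dominate and nothing new dominates
    ([hits_fill], [hits_core]).  Short paths and cycles have explicit
    colourings; where the maximum is below both six and the number of edges,
    a search through all colourings up to renaming of the colours gives
    the upper bound ([growth_string_of_seq], [EC_leq_of_no_string]). *)

(** * Edge coalition partitions as colourings *)

(** The index type carries the closed neighbourhood relation of the line graph:
    an edge meets itself, hence [r] is reflexive and domination needs no
    separate clause for the members of the dominating set. *)
Definition edge_model (G : sgraph) (I : finType) (r : rel I) : Prop :=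
  exists e : I -> {set G},
    [/\ injective e, edges G = [set e x | x in I]
      & forall x y, (e x :&: e y != set0) = r x y].

Definition dominating (I : finType) (r : rel I) (S : {set I}) : bool :=
  [forall x, exists y in S, r x y].

(** The partner colour [b] is automatically different from [a], since the class
    of [a] alone does not dominate. *)
Definition coalition_colouring (I : finType) (r : rel I) (K : finType)
    (c : I -> K) : Prop :=
  (forall a, exists x, c x = a) /\
  (forall a, (#|c @^-1: [set a]| == 1) && dominating r (c @^-1: [set a])
    \/ ~~ dominating r (c @^-1: [set a]) /\
       exists2 b, ~~ dominating r (c @^-1: [set b])
                & dominating r (c @^-1: [set a; b])).

Lemma dominatingP (I : finType) (r : rel I) (S : {set I}) :
  reflect (forall x, exists2 y, y \in S & r x y) (dominating r S).
Proof. exact: (iffP 'forall_exists_inP). Qed.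

Lemma in_class (I K : finType) (c : I -> K) (a : K) x :
  (x \in c @^-1: [set a]) = (c x == a).
Proof. by rewrite !inE. Qed.

Lemma class_pair (I K : finType) (c : I -> K) (a b : K) :
  c @^-1: [set a; b] = c @^-1: [set a] :|: c @^-1: [set b].
Proof. exact: preimsetU. Qed.

Section Transfer.

Variables (G : sgraph) (I : finType) (r : rel I) (e : I -> {set G}).
Hypotheses (e_inj : injective e) (e_edges : edges G = [set e x | x in I])
  (e_meet : forall x y, (e x :&: e y != set0) = r x y).

Lemma model_refl x : r x x.
Proof.
have : e x \in edges G by rewrite e_edges imset_f.
case/imsetP=> u _ ex; rewrite -e_meet setIid ex.
by apply/set0Pn; exists u.1; rewrite !inE eqxx.
Qed.

Lemma edge_dominating_model (S : {set I}) :
  edge_dominating (e @: S) = dominating r S.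
Proof.
apply/andP/dominatingP => [[_ /forall_inP domS] x | domS].
  case exS: (e x \in e @: S).
    by exists x; rewrite ?model_refl // -(mem_imset _ _ e_inj).
  have /domS/exists_inP[d /imsetP[y yS ->] /andP[_ meet]] :
      e x \in edges G :\: e @: S by rewrite inE exS e_edges imset_f.
  by exists y; rewrite // -e_meet.
split; first by rewrite e_edges; apply/imsetS/subsetP.
apply/forall_inP => f; rewrite inE e_edges => /andP[fS /imsetP[x _ def_f]].
have [y yS rxy] := domS x; apply/exists_inP; exists (e y); first exact: imset_f.
rewrite /edge_adj def_f e_meet rxy andbT.
by apply: contraNneq fS => def_ex; rewrite def_f def_ex imset_f.
Qed.

Lemma ec_partition_of_colouring (K : finType) (c : I -> K) :
  coalition_colouring r c -> exists2 P, @ec_partition G P & #|P| = #|K|.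
Proof.
case=> c_surj c_coal.
pose E a : {set {set G}} := e @: (c @^-1: [set a]).
have memE a x : (e x \in E a) = (c x == a).
  by rewrite mem_imset // in_class.
have E_disj a b : b != a -> [disjoint E a & E b].
  move=> ne_ba; apply/pred0P => f /=; apply/negP => /andP[].
  case/imsetP=> x; rewrite in_class => /eqP cx ->.
  by rewrite memE cx eq_sym (negPf ne_ba).
have E_non0 : set0 \notin [set E a | a in K].
  apply/imsetP => -[a _ Ea0]; have [x cx] := c_surj a.
  by have := memE a x; rewrite -Ea0 inE cx eqxx.
have [|E_triv E_inj] := trivIimset (F := E) (J := K) _ E_non0.
  by move=> a b _ _; apply: E_disj.
have dom1 a : edge_dominating (E a) = dominating r (c @^-1: [set a]).
  exact: edge_dominating_model.
have dom2 a b : edge_dominating (E a :|: E b) = dominating r (c @^-1: [set a; b]).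
  by rewrite -imsetU -class_pair edge_dominating_model.
exists [set E a | a in K]; last by rewrite card_in_imset.
apply/andP; split.
  apply/and3P; split=> //; apply/eqP/setP => f; rewrite e_edges.
  apply/bigcupP/imsetP => [[_ /imsetP[a _ ->] /imsetP[x _ ->]] | [x _ ->]].
    by exists x.
  by exists (E (c x)); rewrite ?memE // imset_f.
apply/forall_inP => _ /imsetP[a _ ->]; rewrite dom1 card_imset //.
case: (c_coal a) => [-> // | [ndom_a [b ndom_b dom_ab]]].
have ne_ba : b != a.
  by apply: contraNneq ndom_a => def_b; rewrite def_b setUid in dom_ab.
rewrite ndom_a; apply/orP; right; apply/exists_inP; exists (E b).
  rewrite !inE imset_f // andbT.
  by apply: contraNneq ne_ba => /E_inj->.
by rewrite /edge_coalition E_disj // !dom1 dom2 ndom_a ndom_b.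
Qed.

Lemma colouring_of_ec_partition P : @ec_partition G P ->
  exists c : I -> {A | A \in P}, coalition_colouring r c.
Proof.
case/andP=> partP coalP; have /and3P[/eqP coverP trivP P_non0] := partP.
have in_cover x : e x \in cover P by rewrite coverP e_edges imset_f.
pose c x : {A | A \in P} := exist _ (pblock P (e x)) (pblock_mem (in_cover x)).
have classE A : e @: (c @^-1: [set A]) = val A.
  have AP := valP A; apply/setP=> f; apply/imsetP/idP => [[x] | fA].
    by rewrite in_class => /eqP <- ->; rewrite mem_pblock.
  have /imsetP[x _ def_f]: f \in [set e x | x in I].
    by rewrite -e_edges -coverP; apply/bigcupP; exists (val A).
  exists x => //; rewrite in_class; apply/eqP/val_inj => /=.
  by apply: def_pblock; rewrite // -def_f.
exists c; split=> [A | A].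
  have /set0Pn[f]: val A != set0 by apply: contraNneq P_non0 => <-; apply: valP.
  rewrite -classE => /imsetP[x]; rewrite in_class => /eqP cx _; by exists x.
have /forall_inP/(_ _ (valP A)) := coalP.
rewrite -classE card_imset // edge_dominating_model classE.
case/orP=> [dom_A | /andP[ndom_A /exists_inP[B]]]; first by left.
case/setD1P=> _ BP /and4P[_ _ ndom_B dom_AB]; right; split=> //.
exists (exist _ B BP); first by rewrite -edge_dominating_model classE.
by rewrite class_pair -edge_dominating_model imsetU !classE.
Qed.

End Transfer.

Lemma leq_EC (G : sgraph) (I : finType) (r : rel I) (K : finType) (c : I -> K) :
  edge_model G r -> coalition_colouring r c -> #|K| <= EC G.
Proof.
case=> e [e_inj e_edges e_meet] c_coal.
have [P ecP <-] := ec_partition_of_colouring e_inj e_edges e_meet c_coal.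
exact: (@leq_bigmax_cond _ (@ec_partition G) (fun P => #|P|)) ecP.
Qed.

Lemma EC_leq (G : sgraph) (I : finType) (r : rel I) k :
  edge_model G r ->
  (forall (K : finType) (c : I -> K), coalition_colouring r c -> #|K| <= k) ->
  EC G <= k.
Proof.
case=> e [e_inj e_edges e_meet] bound; apply/bigmax_leqP => P ecP.
have [c c_coal] := colouring_of_ec_partition e_inj e_edges e_meet ecP.
by have := bound _ _ c_coal; rewrite card_sig; congr (_ <= _); apply: eq_card.
Qed.

Lemma card_colours (I : finType) (r : rel I) (K : finType) (c : I -> K) :
  coalition_colouring r c -> #|K| <= #|I|.
Proof.
case=> c_surj _; rewrite -cardsT; apply: leq_trans (leq_imset_card c I).
by apply/subset_leq_card/subsetP => a _; have [x <-] := c_surj a; apply: imset_f.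
Qed.

(** The partition into singletons is an ec-partition here, and no partition
    has more blocks than there are edges. *)
Lemma EC_eq_card (G : sgraph) (I : finType) (r : rel I) :
  edge_model G r ->
  (forall x, [forall z, r z x] \/
     exists2 y, ~~ [forall z, r z y] & forall z, r z x || r z y) ->
  EC G = #|I|.
Proof.
move=> model pair_dom; apply/eqP; rewrite eqn_leq; apply/andP; split.
  by apply: EC_leq model _ => K c; apply: card_colours.
have dom1 a : dominating r (id @^-1: [set a]) = [forall z, r z a].
  apply/dominatingP/forallP => dom z.
    by have [y] := dom z; rewrite in_class => /eqP ->.
  by exists a; rewrite ?in_class.
apply: (leq_EC (c := id)) model _; split=> x; first by exists x.
have -> : #|id @^-1: [set x]| = 1.
  by rewrite -(cards1 x); apply: eq_card => z; rewrite !inE.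
rewrite dom1 /=; case: (boolP [forall z, r z x]) => [_ | ndom]; first by left.
right; split=> //; have [dom_x | [y ndom_y xy_dom]] := pair_dom x.
  by rewrite dom_x in ndom.
exists y; rewrite ?dom1 //; apply/dominatingP => z.
by case/orP: (xy_dom z) => rz; [exists x | exists y]; rewrite ?inE ?eqxx ?orbT.
Qed.

(** * At most six colours when every edge meets at most three *)

Section SmallCovers.

Variables (K : finType) (h : rel K).
Hypothesis h_sym : symmetric h.
Hypothesis no_isolated : forall a, exists b, h a b.

Definition vertex_cover (M : {set K}) : Prop :=
  forall x y, h x y -> (x \in M) || (y \in M).

Hypothesis small_covers :
  forall a, exists M : {set K}, [/\ #|M| <= 3, a \notin M & vertex_cover M].

(** Let [V] be a cover of size at most 3; its complement [U] is independent, so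
    each vertex of [U] has a neighbour in [V].  Write [F v] for the neighbours
    of [v] in [U].  A cover [M] avoiding [v] contains [F v].  With seven
    vertices [U] has at least four, so [M] misses some [w] in [U], and a
    neighbour of [w] in [V] lies in [M]: hence [F v] has at most two elements.
    By counting, some [F v] has exactly two; then [M] consists of [F v] and one
    vertex [v'] of [V], and [F v'] contains the rest of [U].  By symmetry a
    cover [M'] avoiding [v'] consists of [F v'] and [v].  A third vertex [z] of [V] is in neither cover,
    so its neighbours lie in the intersection of [M] and [M'], which is
    empty. *)
Lemma card_leq6_of_small_covers : #|K| <= 6.
Proof.
rewrite leqNgt; apply/negP => K_gt6.
have /card_gt0P[a0 _] : 0 < #|K| by apply: leq_trans K_gt6.
have [V [V_le3 _ coverV]] := small_covers a0.
pose U := ~: V; pose F v := [set w in U | h v w].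
have cardVU : #|V| + #|U| = #|K| by rewrite cardsC.
have U_ge4 : 4 <= #|U|.
  rewrite -(leq_add2l #|V|) cardVU; apply: leq_trans K_gt6.
  by rewrite (leq_add2r 4 _ 3).
have notU v : v \in V -> v \in U = false by rewrite inE => ->.
have notF u v : v \in V -> v \in F u = false by rewrite inE => /notU->.
have partner w : w \in U -> exists2 v, v \in V & h v w.
  rewrite inE => wV; have [v h_wv] := no_isolated w.
  by exists v; [move: (coverV _ _ h_wv); rewrite (negPf wV) | rewrite h_sym].
have big v : v \in V -> 2 <= #|F v| ->
    exists v' M, [/\ v' \in V, v' != v, U :\: F v \subset F v', #|F v| = 2
                   & vertex_cover M /\ M = v' |: F v].
  move=> vV F_ge2; have [M [M_le3 vM coverM]] := small_covers v.
  have FM : F v \subset M.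
    apply/subsetP=> w; rewrite inE => /andP[_ /coverM].
    by rewrite (negPf vM).
  have /subsetPn[w wU wM] : ~~ (U \subset M).
    apply: contraL U_ge4 => /subset_leq_card UM.
    by rewrite -ltnNge ltnS (leq_trans UM).
  have [v' v'V h_v'w] := partner w wU.
  have v'M : v' \in M by have := coverM _ _ h_v'w; rewrite (negPf wM) orbF.
  have card_FM : #|v' |: F v| = #|F v|.+1 by rewrite cardsU1 notF.
  have F_eq2 : #|F v| = 2.
    apply/eqP; rewrite eqn_leq F_ge2 andbT -ltnS -card_FM.
    by apply: leq_trans M_le3; apply/subset_leq_card; rewrite subUset sub1set v'M.
  have defM : M = v' |: F v.
    apply/eqP; rewrite eq_sym eqEcard subUset sub1set v'M FM card_FM F_eq2.
    exact: M_le3.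
  exists v', M; split=> //; first by apply: contraNneq vM => <-.
  apply/subsetP=> u /setDP[uU uF]; have [t tV h_tu] := partner u uU.
  have := coverM _ _ h_tu; rewrite defM !in_setU1 (negPf uF) notF // !orbF.
  have -> : u == v' = false by apply: contraTF uU => /eqP->; rewrite notU.
  by rewrite orbF => /eqP def_t; rewrite inE uU -def_t.
(* Otherwise the sets [F v], for the at most three [v] in [V], could not cover
   the four vertices of [U]. *)
have [v vV F_ge2] : exists2 v, v \in V & 2 <= #|F v|.
  apply/exists_inP; apply: contraLR U_ge4 => /exists_inPn F_small.
  rewrite -ltnNge ltnS; apply: leq_trans V_le3.
  have U_cup : U \subset \bigcup_(v in V) F v.
    apply/subsetP=> w wU; have [v vV h_vw] := partner w wU.
    by apply/bigcupP; exists v; rewrite // inE wU.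
  have cup_le : #|\bigcup_(v in V) F v| <= \sum_(v in V) #|F v|.
    elim/big_ind2: _ => [|A m B n leAm leBn|//]; first by rewrite cards0.
    by apply: leq_trans (leq_add leAm leBn); rewrite leq_card_setU.
  apply: leq_trans (subset_leq_card U_cup) (leq_trans cup_le _).
  rewrite -sum1_card; apply: leq_sum => v /F_small.
  by rewrite -ltnNge.
have [v' [M [v'V v'v UFv' Fv_2 [coverM defM]]]] := big v vV F_ge2.
have Fv'_ge2 : 2 <= #|F v'|.
  apply: leq_trans (subset_leq_card UFv').
  rewrite cardsDS; last by apply/subsetP=> w; rewrite inE => /andP[].
  by rewrite Fv_2 leq_subRL // (leq_trans _ U_ge4).
have [v'' [M' [v''V _ UFv Fv'_2 [coverM' defM']]]] := big v' v'V Fv'_ge2.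
have U_sub : U \subset F v :|: F v' by rewrite -subDset.
have F_disj : F v :&: F v' = set0.
  apply/eqP; rewrite -cards_eq0.
  have := leq_trans U_ge4 (subset_leq_card U_sub).
  by rewrite cardsU Fv_2 Fv'_2; case: #|_ :&: _| => [|[|[|[]]]].
have F_not w : w \in F v -> w \in F v' = false.
  by move=> wF; apply/negP => wF'; have := in_set0 w; rewrite -F_disj inE wF wF'.
(* An edge from [v] to [F v] has to be covered by [M'], which contains no
   vertex of [F v]. *)
have def_v'' : v'' = v.
  have /card_gt0P[w wF] : 0 < #|F v| by rewrite Fv_2.
  have [wU h_vw] : w \in U /\ h v w by move: wF; rewrite inE => /andP[].
  have := coverM' _ _ h_vw.
  rewrite defM' !in_setU1 (F_not w wF) (notF v' v vV) !orbF.
  have -> : w == v'' = false by apply: contraTF wU => /eqP->; rewrite notU.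
  by rewrite orbF => /eqP.
(* [U] has at most four vertices, hence [V] has at least three. *)
have /subsetPn[z zV] : ~~ (V \subset [set v; v']).
  apply: contraL K_gt6 => /subset_leq_card; rewrite cards2 eq_sym v'v => V_le2.
  rewrite -leqNgt -cardVU -[6]/(2 + 4) leq_add //.
  apply: leq_trans (subset_leq_card U_sub) _.
  by rewrite cardsU Fv_2 Fv'_2 leq_subr.
rewrite !inE negb_or => /andP[zv zv']; have [b h_zb] := no_isolated z.
have := coverM _ _ h_zb; rewrite defM !in_setU1 (negPf zv') notF //=.
have := coverM' _ _ h_zb; rewrite defM' def_v'' !in_setU1 (negPf zv) notF //=.
case/predU1P=> [-> | bF']; first by rewrite eq_sym (negPf v'v) notF.
case/predU1P=> [def_b | bF]; first by rewrite def_b notF in bF'.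
by rewrite F_not in bF'.
Qed.

End SmallCovers.

Section BoundedDegree.

Variables (I : finType) (r : rel I).
Hypotheses (r_sym : symmetric r) (r_small : forall x, #|[set y | r x y]| <= 3)
  (I_large : 4 <= #|I|).

(** A dominating singleton would meet all edges, and there are more than three;
    so only the second alternative of a coalition colouring remains. *)
Lemma dominating_pair (K : finType) (c : I -> K) (a : K) :
  coalition_colouring r c ->
  ~~ dominating r (c @^-1: [set a]) /\
  exists b, dominating r (c @^-1: [set a; b]).
Proof.
case=> _ /(_ a)[/andP[/cards1P[x def_a] dom_a] | [ndom_a [b _ dom_ab]]].
  suff : #|I| <= 3 by rewrite leqNgt I_large.
  apply: leq_trans (r_small x); rewrite -cardsT; apply/subset_leq_card/subsetP.
  move=> z _; rewrite inE r_sym; have [y] := elimT (dominatingP _ _) dom_a z.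
  by rewrite def_a => /set1P->.
by split=> //; exists b.
Qed.

(** The covers avoiding [a] are the sets of colours around an edge that the
    class of [a] does not dominate: each dominating pair has a colour there. *)
Lemma card_colours_leq6 (K : finType) (c : I -> K) :
  coalition_colouring r c -> #|K| <= 6.
Proof.
move=> c_coal.
apply: (@card_leq6_of_small_covers K
          (fun a b => dominating r (c @^-1: [set a; b]))) => [a b | a | a].
- by rewrite setUC.
- by have [] := dominating_pair a c_coal.
have [/forallPn[x /exists_inPn x_far] _] := dominating_pair a c_coal.
exists (c @: [set y | r x y]); split.
- exact: leq_trans (leq_imset_card _ _) (r_small x).
- apply/imsetP=> -[y]; rewrite inE => rxy def_a.
  by have := x_far y; rewrite in_class def_a eqxx rxy => /(_ isT).
move=> b1 b2 /dominatingP/(_ x)[y]; rewrite !inE => c_y rxy.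
by case/orP: c_y => /eqP<-; rewrite imset_f ?orbT // inE.
Qed.

End BoundedDegree.

(** * Colourings of edges indexed by natural numbers *)

Definition nat_rel m (nb : nat -> seq nat) : rel 'I_m :=
  fun i j => (j : nat) \in nb i.

(** Domination in a form that evaluates: [p] selects the colours whose classes
    are united, and [nb i] lists the edges meeting edge [i]. *)
Definition hits m (nb : nat -> seq nat) (f : nat -> nat) (p : pred nat) : bool :=
  all (fun i => has (fun j => p (f j)) (nb i)) (iota 0 m).

Lemma hitsP m nb f p :
  reflect (forall i, i < m -> has (fun j => p (f j)) (nb i)) (hits m nb f p).
Proof.
apply: (iffP allP) => hit i im; apply: hit; first by rewrite mem_iota.
by rewrite mem_iota in im.
Qed.

Definition nb_bounded m (nb : nat -> seq nat) : Prop :=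
  forall i, i < m -> {in nb i, forall j, j < m}.

Lemma dominating_hits m nb (K : finType) (c : 'I_m -> K) (S : {set K})
    (f : nat -> nat) (p : pred nat) :
  nb_bounded m nb -> (forall i : 'I_m, (c i \in S) = p (f i)) ->
  dominating (nat_rel nb) (c @^-1: S) = hits m nb f p.
Proof.
move=> nb_m cS; apply/dominatingP/hitsP => [dom i im | hit i].
  have [j] := dom (Ordinal im); rewrite inE cS => pj ij.
  by apply/hasP; exists (j : nat).
have /hasP[j ij pj] := hit i (ltn_ord i).
by exists (Ordinal (nb_m _ (ltn_ord i) _ ij)); rewrite // inE cS.
Qed.

Definition valid_colouring m nb k f : bool :=
  [&& all (fun i => f i < k) (iota 0 m),
      all (fun a => has (fun i => f i == a) (iota 0 m)) (iota 0 k)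
    & all (fun a =>
        (count (fun i => f i == a) (iota 0 m) == 1) && hits m nb f (pred1 a)
        || ~~ hits m nb f (pred1 a) &&
           has (fun b => ~~ hits m nb f (pred1 b) && hits m nb f (pred2 a b))
             (iota 0 k)) (iota 0 k)].

Lemma coalition_colouring_of_valid m nb k f :
  nb_bounded m nb -> valid_colouring m nb k f ->
  exists c : 'I_m -> 'I_k, coalition_colouring (nat_rel nb) c.
Proof.
move=> nb_m /and3P[/allP f_lt /allP f_onto /allP f_coal].
have f_ltk (i : 'I_m) : f i < k by apply: f_lt; rewrite mem_iota ltn_ord.
have ltk (a : 'I_k) : (a : nat) \in iota 0 k by rewrite mem_iota ltn_ord.
pose c i := Ordinal (f_ltk i); exists c.
have dom1 a : dominating (nat_rel nb) (c @^-1: [set a])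
               = hits m nb f (pred1 (a : nat)).
  by apply: (dominating_hits nb_m) => j; rewrite inE.
have dom2 a b : dominating (nat_rel nb) (c @^-1: [set a; b])
                = hits m nb f (pred2 (a : nat) (b : nat)).
  by apply: (dominating_hits nb_m) => j; rewrite !inE.
split=> a.
  have /hasP[i] := f_onto a (ltk a); rewrite mem_iota => im /eqP fi.
  by exists (Ordinal im); apply: val_inj.
rewrite dom1.
have /orP[/andP[/eqP count1 ->] | /andP[-> /hasP[b]]] := f_coal a (ltk a).
  left; rewrite andbT -count1 -val_enum_ord count_map cardE size_filter -enumT.
  by apply/eqP/eq_count => i; rewrite /= !inE.
rewrite mem_iota => bk /andP[ndom_b dom_ab]; right; split=> //.
by exists (Ordinal bk); rewrite ?dom1 ?dom2.
Qed.

(** Restricted growth strings: each letter is one of the [k] letters already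
    used or the next unused one, and [q] letters are used at the end.  Every
    colouring is one of them after numbering the colours by first
    occurrence. *)
Fixpoint growth_strings n k q : seq (seq nat) :=
  if n is n'.+1 then
    flatten [seq [seq j :: s | s <- growth_strings n' (if j == k then k.+1 else k) q]
            | j <- iota 0 (minn k.+1 q)]
  else if k == q then [:: [::]] else [::].

(** [u] lists the colours met before [s] and [v] those that [s] introduces, in
    order of first occurrence. *)
Lemma growth_string_of_seq (T : eqType) (s u : seq T) : uniq u ->
  exists v, [/\ uniq (u ++ v), {subset s <= u ++ v}
    & [seq index x (u ++ v) | x <- s]
        \in growth_strings (size s) (size u) (size (u ++ v))].
Proof.
elim: s u => [|x s IHs] u uniq_u /=.
  by exists [::]; rewrite cats0 eqxx inE.
have [xu | xu] := boolP (x \in u).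
  have [v [uniq_uv s_uv in_uv]] := IHs u uniq_u; exists v; split=> //.
    by move=> y /predU1P[-> | /s_uv//]; rewrite mem_cat xu.
  have lt_x : index x u < size u by rewrite index_mem.
  apply/flattenP; exists
    [seq index x u :: s' | s' <- growth_strings (size s) (size u) (size (u ++ v))];
    last first.
    by rewrite index_cat xu map_f.
  apply/mapP; exists (index x u); last by rewrite ltn_eqF.
  by rewrite mem_iota /= leq_min ltnS ltnW //= size_cat ltn_addr.
have uniq_ux : uniq (rcons u x) by rewrite rcons_uniq xu.
have [v] := IHs _ uniq_ux; rewrite cat_rcons size_rcons => -[uniq_uv s_uv in_uv].
exists (x :: v); split=> //.
  by move=> y /predU1P[-> | /s_uv//]; rewrite mem_cat mem_head orbT.
apply/flattenP; exists
  [seq size u :: s' | s' <- growth_strings (size s) (size u).+1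
                            (size (u ++ x :: v))]; last first.
  by rewrite index_cat (negPf xu) /= eqxx addn0 map_f.
apply/mapP; exists (size u); last by rewrite eqxx.
by rewrite mem_iota /= leq_min leqnn size_cat /= addnS ltnS leq_addr.
Qed.

(** Dominating singletons are ignored, which is harmless by [dominating_pair]
    as soon as there are four edges meeting at most three each. *)
Definition no_coalition_string m nb k : bool :=
  all (fun s => ~~ all (fun a => ~~ hits m nb (nth 0 s) (pred1 a) &&
                 has (fun b => hits m nb (nth 0 s) (pred2 a b)) (iota 0 k))
               (iota 0 k))
    (growth_strings m 0 k).

Lemma edge_model_sym (G : sgraph) (I : finType) (r : rel I) :
  edge_model G r -> symmetric r.
Proof. by case=> e [_ _ e_meet] x y; rewrite -!e_meet setIC. Qed.

Lemma nat_rel_degree m (nb : nat -> seq nat) (i : 'I_m) :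
  size (nb i) <= 3 -> #|[set j | nat_rel nb i j]| <= 3.
Proof.
rewrite cardE -(size_map val) => nb_small; apply: leq_trans nb_small.
apply: uniq_leq_size; first by rewrite (map_inj_uniq val_inj) enum_uniq.
by move=> _ /mapP[j ij ->]; move: ij; rewrite mem_enum inE.
Qed.

Section BoundedModel.

Variables (G : sgraph) (m : nat) (nb : nat -> seq nat).
Hypotheses (model : edge_model G (nat_rel (m := m) nb))
  (nb_m : nb_bounded m nb) (nb_small : forall i, size (nb i) <= 3)
  (m_ge4 : 4 <= m).

Let r_sym : symmetric (nat_rel nb) := edge_model_sym model.
Let r_small (i : 'I_m) : #|[set j | nat_rel nb i j]| <= 3 :=
  nat_rel_degree (nb_small i).
Let I_large : 4 <= #|'I_m|.
Proof. by rewrite card_ord. Qed.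

Lemma EC_leq6 : EC G <= 6.
Proof.
apply: EC_leq model _ => K c; exact: (card_colours_leq6 r_sym r_small I_large).
Qed.

Lemma card_colours_neq k (K : finType) (c : 'I_m -> K) :
  no_coalition_string m nb k -> coalition_colouring (nat_rel nb) c -> #|K| != k.
Proof.
move=> no_string c_coal; apply/eqP => card_K.
pose t := [seq c i | i <- enum 'I_m].
have [u [/= uniq_u t_u]] := growth_string_of_seq t (isT : uniq [::]).
have u_full x : x \in u.
  by have [i def_x] := c_coal.1 x; apply: t_u; rewrite -def_x map_f ?mem_enum.
have size_u : size u = k.
  rewrite -card_K; apply/esym; rewrite -(card_uniqP uniq_u).
  by apply: eq_card => x; rewrite u_full.
rewrite size_u size_map size_enum_ord => /(allP no_string)/negP[].
pose f := nth 0 [seq index x u | x <- t].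
have fE (i : 'I_m) : f i = index (c i) u.
  by rewrite /f /t -map_comp (nth_map i) ?size_enum_ord // nth_ord_enum.
have index_eq x y : (x == y) = (index x u == index y u).
  apply/eqP/eqP => [-> // | eq_xy].
  by rewrite -(nth_index x (u_full x)) eq_xy nth_index.
have dom1 x : dominating (nat_rel nb) (c @^-1: [set x])
              = hits m nb f (pred1 (index x u)).
  by apply: (dominating_hits nb_m) => j; rewrite inE fE index_eq.
have dom2 x y : dominating (nat_rel nb) (c @^-1: [set x; y])
                = hits m nb f (pred2 (index x u) (index y u)).
  by apply: (dominating_hits nb_m) => j; rewrite !inE fE !index_eq.
apply/allP => a; rewrite mem_iota /= -{1}size_u => au.
have [x def_a] : exists x, index x u = a.
  case: (u) uniq_u au => // x0 u' uniq_u au.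
  by exists (nth x0 (x0 :: u') a); rewrite index_uniq.
have [ndom_x [y dom_xy]] := dominating_pair r_sym r_small I_large x c_coal.
rewrite -def_a -dom1 ndom_x; apply/hasP; exists (index y u).
  by rewrite mem_iota -size_u index_mem u_full.
by rewrite -dom2.
Qed.

(** Orders above [k.+1] are excluded by the number of edges or by the general
    bound 6, so that only colourings with exactly [k.+1] colours need to be
    searched. *)
Lemma EC_leq_of_no_string k :
  no_coalition_string m nb k.+1 -> minn m 6 <= k.+1 -> EC G <= k.
Proof.
move=> no_string le_k; apply: EC_leq model _ => K c c_coal.
rewrite -ltnS ltn_neqAle (card_colours_neq no_string c_coal) (leq_trans _ le_k) //.
rewrite leq_min (card_colours_leq6 r_sym r_small I_large c_coal) andbT.
by rewrite -[leqRHS](card_ord m) (card_colours c_coal).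
Qed.

End BoundedModel.

Lemma leq_EC_of_valid G m nb k f :
  edge_model G (nat_rel (m := m) nb) -> nb_bounded m nb ->
  valid_colouring m nb k f -> k <= EC G.
Proof.
move=> model nb_m /(coalition_colouring_of_valid nb_m)[c c_coal].
by rewrite -(card_ord k); apply: leq_EC model c_coal.
Qed.

Lemma EC_leq_size G m nb : edge_model G (nat_rel (m := m) nb) -> EC G <= m.
Proof.
move=> model; rewrite -[leqRHS](card_ord m).
by apply: EC_leq model _ => K c; apply: card_colours.
Qed.

(** [T] continued by 0, 1, 0, 1, ... *)
Definition fill (T : seq nat) i : nat :=
  if i < size T then nth 0 T i else odd (i - size T).

(** A coalition colouring, ending in 0, 1, in which every colour has a partner
    such that 0 or 1 belongs to the pair; a pair without them would not
    dominate a proper continuation of [T]. *)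
Definition extensible_core (nb : nat -> seq nat) k (T : seq nat) : bool :=
  [&& 1 < size T, nth 0 T (size T).-2 == 0, nth 0 T (size T).-1 == 1,
      1 < k, all (fun a => a < k) T, all (fun a => a \in T) (iota 0 k)
    & all (fun a => ~~ hits (size T) nb (fill T) (pred1 a) &&
        has (fun b => [&& ~~ hits (size T) nb (fill T) (pred1 b),
                          hits (size T) nb (fill T) (pred2 a b)
                        & (a < 2) || (b < 2)]) (iota 0 k)) (iota 0 k)].

Section Fill.

Variables (nb : nat -> nat -> seq nat) (T : seq nat) (m : nat).
Local Notation t := (size T).
Local Notation f := (fill T).
Hypotheses (t_gt1 : 1 < t) (t_le : t <= m).
Hypotheses (T0 : nth 0 T t.-2 = 0) (T1 : nth 0 T t.-1 = 1).
(* The three hypotheses isolate the common behaviour of paths and cycles: an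
   edge before the last one of the core sees the same colours, a later edge
   meets its predecessor and itself, and the last edge of the core meets only
   its two neighbours in the longer graph, so it sees only 0 and 1 there. *)
Hypothesis nb_core : forall p i, i.+1 < t ->
  has (fun j => p (f j)) (nb m i) = has (fun j => p (f j)) (nb t i).
Hypothesis nb_tail : forall n i, t <= n -> t.-1 <= i < n ->
  (i.-1 \in nb n i) && (i \in nb n i).
Hypothesis nb_end : t < m -> {subset nb m t.-1 <= [:: t.-2; t.-1; t]}.

Lemma fill_core i : i < t -> f i = nth 0 T i.
Proof. by rewrite /fill => ->. Qed.

Lemma fill_tail p i : t.-1 <= i -> p (f i.-1) || p (f i) = p 0 || p 1.
Proof.
rewrite leq_eqVlt => /predU1P[<- | lt_ti].
  by rewrite !fill_core ?T0 ?T1 //; case: (size T) t_gt1 => [|[|]].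
have le_ti : t <= i by rewrite -(prednK (ltnW t_gt1)).
have [d ->] : exists d, i = t + d by exists (i - t); rewrite subnKC.
case: d => [|d]; rewrite /fill.
  rewrite addn0 ltnn subnn prednK ?(ltnW t_gt1) //.
  by rewrite leqnn T1 orbC.
rewrite addnS /= !ltnNge leq_addr /= -addnS leq_addr /= !addKn /=.
by case: (odd d); rewrite // orbC.
Qed.

(** Every edge from the end of the core on has the colours 0 and 1 around it. *)
Lemma hits_fill p : p 0 || p 1 -> hits t (nb t) f p -> hits m (nb m) f p.
Proof.
move=> p01 /hitsP hit; apply/hitsP => i im.
have [le_ti | lt_it] := leqP t.-1 i.
  have /andP[nb_i1 nb_i] := nb_tail t_le (introT andP (conj le_ti im)).
  rewrite -(fill_tail p le_ti) in p01.
  by apply/hasP; case/orP: p01 => pf; [exists i.-1 | exists i].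
by rewrite nb_core ?hit // -1?ltn_predRL // (leq_trans lt_it) ?leq_pred.
Qed.

(** The only core edge that may see other colours than before is the last one.
    In the longer graph it sees the colours 0 and 1 only, and it sees both of
    them in the core already. *)
Lemma hits_core p : hits m (nb m) f p -> hits t (nb t) f p.
Proof.
move=> /hitsP hit; apply/hitsP => i it.
have im : i < m := leq_trans it t_le.
have [le_ti | lt_it] := leqP t.-1 i; last by rewrite -nb_core ?hit // -ltn_predRL.
have def_i : i = t.-1.
  by apply/eqP; rewrite eqn_leq le_ti andbT -ltnS prednK // ltnW.
move: t_le; rewrite leq_eqVlt => /predU1P[-> | lt_tm]; first exact: hit.
have p01 : p 0 || p 1.
  have /hasP[j] := hit i im; rewrite def_i => /(nb_end lt_tm).
  rewrite !inE => /or3P[] /eqP-> pj.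
  - by move: pj; rewrite fill_core ?T0 => [->|] //; case: (size T) t_gt1 => [|[|]].
  - by move: pj; rewrite fill_core ?T1 => [->|]; rewrite ?orbT // ltn_predL ltnW.
  - by move: pj; rewrite /fill ltnn subnn => ->.
have /andP[nb_i1 nb_i] := nb_tail (leqnn t) (introT andP (conj le_ti it)).
rewrite -(fill_tail p le_ti) in p01.
by apply/hasP; case/orP: p01 => pf; [exists i.-1 | exists i].
Qed.

End Fill.

Lemma valid_fill nb k T m : size T <= m ->
  extensible_core (nb (size T)) k T ->
  (forall p i, i.+1 < size T ->
    has (fun j => p (fill T j)) (nb m i)
    = has (fun j => p (fill T j)) (nb (size T) i)) ->
  (forall n i, size T <= n -> (size T).-1 <= i < n ->
     (i.-1 \in nb n i) && (i \in nb n i)) ->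
  (size T < m ->
     {subset nb m (size T).-1 <= [:: (size T).-2; (size T).-1; size T]}) ->
  valid_colouring m (nb m) k (fill T).
Proof.
move=> t_le /and5P[t_gt1 /eqP T0 /eqP T1 k_gt1].
move=> /and3P[/allP T_ltk /allP T_onto /allP T_coal].
move=> nb_core nb_tail nb_end; apply/and3P; split.
- apply/allP => i _; rewrite /fill; case: (ltnP i (size T)) => [it | _].
    exact: T_ltk (mem_nth 0 it).
  by apply: leq_ltn_trans k_gt1; case: (odd _).
- apply/allP => a /T_onto aT; apply/hasP; exists (index a T); last first.
    by rewrite fill_core ?index_mem // nth_index.
  by rewrite mem_iota (leq_trans _ t_le) // index_mem.
apply/allP => a /T_coal/andP[ndom_a /hasP[b bk /and3P[ndom_b dom_ab ab2]]].
have ndom c : ~~ hits (size T) (nb (size T)) (fill T) (pred1 c) ->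
    ~~ hits m (nb m) (fill T) (pred1 c).
  by apply: contra => /(hits_core t_gt1 t_le T0 T1 nb_core nb_tail nb_end).
rewrite ndom // orbC; apply/orP; left; apply/hasP; exists b; rewrite // ndom //.
have lt2 d : d < 2 -> (0 == d) || (1 == d) by case: d => [|[|]].
apply: (hits_fill t_gt1 t_le T0 T1 nb_core nb_tail) dom_ab.
by rewrite /= orbACA; case/orP: ab2 => /lt2->; rewrite ?orbT.
Qed.

Definition path_nb m i := [seq j <- [:: i.-1; i; i.+1] | j < m].
Definition cycle_nb m i :=
  [:: if i == 0 then m.-1 else i.-1; i; if i.+1 == m then 0 else i.+1].

Lemma path_nb_bounded m : nb_bounded m (path_nb m).
Proof. by move=> i _ j; rewrite mem_filter => /andP[]. Qed.

Lemma cycle_nb_bounded m : nb_bounded m (cycle_nb m).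
Proof.
move=> i im j; rewrite !inE => /or3P[] /eqP-> //.
  by case: i im => [|i] im /=; [case: m im | apply: ltnW].
by case: eqP => [|/eqP ne_im]; [case: m im | rewrite ltn_neqAle ne_im].
Qed.

Lemma path_nb_small m i : size (path_nb m i) <= 3.
Proof. by rewrite size_filter (leq_trans (count_size _ _)). Qed.

Lemma path_valid_fill k T m : size T <= m ->
  extensible_core (path_nb (size T)) k T ->
  valid_colouring m (path_nb m) k (fill T).
Proof.
move=> t_le core; have t_gt1 : 1 < size T by case/and5P: core.
apply: valid_fill => // [p i it | n i tn /andP[ti i_n] | lt_tm j].
- congr (has _ _); apply: eq_in_filter => j; rewrite !inE => j_nb.
  have jt : j < size T.
    apply: leq_ltn_trans it; case/or3P: j_nb => /eqP-> //.
    exact: leq_trans (leq_pred i) (leqnSn i).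
  by rewrite jt (leq_trans jt).
- by rewrite !mem_filter !inE !eqxx orbT i_n (leq_ltn_trans (leq_pred i) i_n).
by rewrite mem_filter => /andP[_]; rewrite prednK // ltnW.
Qed.

(** The length added is even, so the colouring still ends in 1 and edge 0 sees
    the same colours as in the short cycle. *)
Lemma cycle_valid_fill k T m : size T <= m -> ~~ odd (m - size T) ->
  extensible_core (cycle_nb (size T)) k T ->
  valid_colouring m (cycle_nb m) k (fill T).
Proof.
move=> t_le even_mt core; have [t_gt1 _ /eqP T1 _ _] := and5P core.
have core1 : fill T (size T).-1 = 1 by rewrite fill_core // ltn_predL ltnW.
have last1 : fill T m.-1 = 1.
  move: t_le; rewrite leq_eqVlt => /predU1P[<- // | lt_tm].
  have m_gt0 := leq_ltn_trans (leq0n _) lt_tm.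
  have le_tm1 : size T <= m.-1 by rewrite -ltnS prednK.
  rewrite /fill ltnNge le_tm1 /=; move: even_mt.
  by rewrite -{1}(prednK m_gt0) subSn //= negbK => ->.
apply: valid_fill => // [p i it | n i tn /andP[ti i_n] | lt_tm j].
- rewrite /cycle_nb (ltn_eqF it) (ltn_eqF (leq_trans it t_le)) /=.
  by case: i {it} => [|i] //=; rewrite last1 core1.
- have i_gt0 : 0 < i by apply: leq_trans ti; case: (size T) t_gt1 => [|[|]].
  by rewrite /cycle_nb (gtn_eqF i_gt0) !inE !eqxx orbT.
have t1_gt0 : 0 < (size T).-1 by case: (size T) t_gt1 => [|[|]].
rewrite /cycle_nb (gtn_eqF t1_gt0) prednK ?(ltnW t_gt1) // (ltn_eqF lt_tm).
by [].
Qed.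

(** * Edge models of stars, double stars, paths and cycles *)

Lemma set2_meet (T : finType) (a b c d : T) :
  ([set a; b] :&: [set c; d] != set0) = [|| a == c, a == d, b == c | b == d].
Proof.
apply/set0Pn/idP => [[x] | ].
  by rewrite !inE => /andP[/orP[] /eqP-> /orP[] ->]; rewrite ?orbT.
by case/or4P=> /eqP->; [exists c | exists d | exists c | exists d];
  rewrite !inE !eqxx ?orbT.
Qed.

(** [s x] and [t x] are the endpoints of edge [x]; the last hypothesis says when
    two such pairs intersect. *)
Lemma edge_model_endpoints (G : sgraph) (I : finType) (r : rel I) (s t : I -> G) :
  (forall x, sadj (s x) (t x)) ->
  (forall u v, sadj u v -> exists x, u = s x /\ v = t x \/ v = s x /\ u = t x) ->
  (forall x y, s x = s y -> t x = t y -> x = y) ->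
  (forall x y, s x = t y -> t x = s y -> x = y) ->
  (forall x y, r x y = [|| s x == s y, s x == t y, t x == s y | t x == t y]) ->
  edge_model G r.
Proof.
move=> adj_st adjP inj_st inj_ts rE; exists (fun x => [set s x; t x]); split.
- move=> x y eq_xy.
  have /set2P[sx|sx] : s x \in [set s y; t y] by rewrite -eq_xy set21.
    have /set2P[tx|tx] : t x \in [set s y; t y] by rewrite -eq_xy set22.
      by have := adj_st x; rewrite sx tx sadj_irr.
    exact: inj_st.
  have /set2P[tx|tx] : t x \in [set s y; t y] by rewrite -eq_xy set22.
    exact: inj_ts.
  by have := adj_st x; rewrite sx tx sadj_irr.
- apply/setP=> f; apply/imsetP/imsetP => [[[u v]] | [x _ ->]].
    rewrite inE /= => /adjP[x adj_x] ->; exists x => //.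
    by case: adj_x => -[-> ->]; rewrite // setUC.
  by exists (s x, t x); rewrite // inE adj_st.
by move=> x y; rewrite set2_meet rE.
Qed.

Lemma star_model n : edge_model (star n) (fun _ _ : 'I_n => true).
Proof.
apply: (edge_model_endpoints (s := fun=> star_center n) (t := inr)) => //.
- case=> [i|i] [j|j] //= _; first by exists j; left; rewrite (ord1 i).
  by exists i; right; rewrite (ord1 j).
by move=> x y _ [].
Qed.

Definition double_star_meet p q : rel (option ('I_p + 'I_q)) := fun x y =>
  match x, y with
  | Some (inl _), Some (inr _) | Some (inr _), Some (inl _) => false
  | _, _ => true
  end.

Lemma double_star_model p q :
  edge_model (double_star p q) (@double_star_meet p q).
Proof.
pose s (x : option ('I_p + 'I_q)) : double_star p q :=
  if x is Some (inr _) then inr (star_center q) else inl (star_center p).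
pose t (x : option ('I_p + 'I_q)) : double_star p q :=
  match x with
  | None => inr (star_center q)
  | Some (inl i) => inl (inr i)
  | Some (inr j) => inr (inr j)
  end.
apply: (edge_model_endpoints (s := s) (t := t)).
- by case=> [[i|j]|].
- case=> [[i|i]|[i|i]] [[j|j]|[j|j]] //=; rewrite ?(ord1 i) ?(ord1 j) // => _;
  [ exists (Some (inl j)); by left
  | exists None; by left
  | exists (Some (inl i)); by right
  | exists None; by right
  | exists (Some (inr j)); by left
  | exists (Some (inr i)); by right ].
- by case=> [[i|j]|] [[i'|j']|] // _ [->].
- by case=> [[i|j]|] [[i'|j']|].
- by case=> [[i|j]|] [[i'|j']|] //=; rewrite ?eqxx.
Qed.

(** Edge [i] joins the vertices [i] and [i.+1]. *)
Lemma path_model m : edge_model (path_graph m.+1) (nat_rel (m := m) (path_nb m)).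
Proof.
pose s (i : 'I_m) : path_graph m.+1 := widen_ord (leqnSn m) i.
pose t (i : 'I_m) : path_graph m.+1 := lift ord0 i.
apply: (edge_model_endpoints (s := s) (t := t)) => [i | u v | i j | i j | i j].
- by rewrite /= /path_adj /= /bump add1n eqxx.
- rewrite /= /path_adj => /orP[] /eqP uv.
    have um : u < m by rewrite -ltnS uv.
    by exists (Ordinal um); left; split; apply: val_inj; rewrite //= /bump -uv.
  have vm : v < m by rewrite -ltnS uv.
  by exists (Ordinal vm); right; split; apply: val_inj; rewrite //= /bump -uv.
- by move=> [/val_inj].
- move=> /(congr1 val) /= + /(congr1 val) /=; rewrite /bump !add1n => -> /eqP.
  by rewrite -[X in _ == X]addn0 -addn2 eqn_add2l.
rewrite /nat_rel /path_nb mem_filter ltn_ord !inE -!val_eqE /= /bump !add1n eqSS.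
move: (nat_of_ord i) (nat_of_ord j) => {}i {}j; lia.
Qed.

(** Edge [i] joins [i] to its cyclic successor.  Three vertices are needed for
    different indices to give different edges. *)
Lemma cycle_model k :
  edge_model (cycle_graph k.+3) (nat_rel (m := k.+3) (cycle_nb k.+3)).
Proof.
set n := k.+3; pose s (i : 'I_n) : cycle_graph n := i.
pose t (i : 'I_n) : cycle_graph n := ordS i.
have ordSE (i : 'I_n) : i.+1 %% n = if i.+1 == n then 0 else i.+1.
  case: eqP => [-> | /eqP ne_in]; first exact: modnn.
  by rewrite modn_small // ltn_neqAle ne_in ltn_ord.
apply: (edge_model_endpoints (s := s) (t := t)) => [i | u v | // | i j | i j].
- rewrite /= /cycle_adj -val_eqE /= eqxx andbT ordSE.
  by have := ltn_ord i; rewrite /s /n; case: ifP; lia.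
- rewrite /= /cycle_adj => /andP[_ /orP[] /eqP uv].
    by exists u; left; split=> //; apply: val_inj.
  by exists v; right; split=> //; apply: val_inj.
- move=> /(congr1 val) /= ij /(congr1 val) /= ji; exfalso; move: ij ji.
  rewrite !ordSE /s; have := ltn_ord i; have := ltn_ord j; rewrite /n.
  by do 2!case: ifP; lia.
rewrite /nat_rel /cycle_nb !inE -!val_eqE /= !ordSE /s.
have := ltn_ord i; have := ltn_ord j.
move: (nat_of_ord i) (nat_of_ord j) => {}i {}j; rewrite /n.
by do 3!case: ifP; lia.
Qed.

(** * Values of the edge coalition number *)

Lemma EC_star n : EC (star n) = n.
Proof.
rewrite (EC_eq_card (star_model n)) ?card_ord // => i.
by left; apply/forallP.
Qed.

Lemma EC_double_star p q : EC (double_star p q) = p + q + 1.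
Proof.
rewrite (EC_eq_card (double_star_model p q)) => [|x].
  by rewrite card_option card_sum !card_ord addn1.
have [dom_x | ndom_x] := boolP [forall z, double_star_meet z x]; [by left | right].
case/forallPn: ndom_x => y ndom_y; exists y.
  by apply/forallPn; exists x; case: x y ndom_y => [[i|j]|] [[i'|j']|].
by case=> [[i''|j'']|] //; case: x y ndom_y => [[i|j]|] [[i'|j']|].
Qed.

Lemma path_6_to_9 m : 6 <= m <= 9 -> m \in [:: 6; 7; 8; 9].
Proof. by rewrite !inE; lia. Qed.

Lemma no_six_colours_path m : m \in [:: 6; 7; 8; 9] ->
  no_coalition_string m (path_nb m) 6.
Proof. by rewrite !inE => /or4P[] /eqP->; vm_compute. Qed.

Lemma five_colours_path m : m \in [:: 6; 7; 8; 9] ->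
  exists f, valid_colouring m (path_nb m) 5 f.
Proof.
rewrite !inE => /or4P[] /eqP->.
- by exists (nth 0 [:: 0; 1; 2; 3; 4; 0]).
- by exists (nth 0 [:: 0; 1; 0; 2; 3; 4; 1]).
- by exists (nth 0 [:: 0; 1; 0; 1; 2; 3; 4; 0]).
by exists (nth 0 [:: 0; 1; 0; 0; 1; 2; 3; 4; 0]).
Qed.

Lemma EC_path m : EC (path_graph m.+1) =
  if m <= 4 then m else if m == 5 then 4 else if m <= 9 then 5 else 6.
Proof.
have model := path_model m; have nb_m := @path_nb_bounded m.
have upper := EC_leq_of_no_string model nb_m (path_nb_small m).
have lower k f := @leq_EC_of_valid _ m _ k f model nb_m.
have [m_le4 | m_gt4] := leqP m 4.
  apply/eqP; rewrite eqn_leq (EC_leq_size model) (lower m id) //.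
  by move: m_le4 {model nb_m upper lower}; do 5?[case: m => [|m] //].
case: (m =P 5) => [def_m | m_neq5].
  subst m; apply/eqP; rewrite eqn_leq upper //=.
  by apply: (lower 4 (nth 0 [:: 0; 1; 0; 2; 3])).
have m_gt3 : 4 <= m := ltnW m_gt4.
have [m_le9 | m_gt9] := leqP m 9.
  have m69 : m \in [:: 6; 7; 8; 9] by apply: path_6_to_9; lia.
  have [f f_valid] := five_colours_path m69.
  apply/eqP; rewrite eqn_leq (lower 5 f) // andbT.
  by apply: upper => //; [apply: no_six_colours_path | apply: geq_minr].
apply/eqP; rewrite eqn_leq (EC_leq6 model (path_nb_small m) m_gt3) /=.
apply: (lower 6 (fill [:: 0; 1; 2; 3; 1; 0; 4; 5; 0; 1])).
exact: path_valid_fill.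
Qed.

Lemma EC_cycle n : 3 <= n ->
  EC (cycle_graph n) = if n <= 6 then n else if n == 7 then 5 else 6.
Proof.
move=> n_ge3.
have model : edge_model (cycle_graph n) (nat_rel (m := n) (cycle_nb n)).
  by case: n n_ge3 => [|[|[|k]]] // _; apply: cycle_model.
have nb_n := @cycle_nb_bounded n; have nb_small i : size (cycle_nb n i) <= 3 by [].
have lower k f := @leq_EC_of_valid _ n _ k f model nb_n.
have [n_le6 | n_gt6] := leqP n 6.
  apply/eqP; rewrite eqn_leq (EC_leq_size model) (lower n id) //.
  by move: n_ge3 n_le6 {model nb_n nb_small lower}; do 7?[case: n => [|n] //].
have n_ge4 : 4 <= n by lia.
case: (n =P 7) => [def_n | n_neq7].
  have := EC_leq_of_no_string (k := 5) model nb_n nb_small n_ge4.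
  subst n => upper; apply/eqP; rewrite eqn_leq upper //=.
  by apply: (lower 5 (nth 0 [:: 0; 0; 1; 2; 3; 4; 1])).
apply/eqP; rewrite eqn_leq (EC_leq6 model nb_small n_ge4) /=.
have [n_even | n_odd] := boolP (~~ odd n).
  apply: (lower 6 (fill [:: 2; 3; 1; 0; 4; 5; 0; 1])).
  by apply: cycle_valid_fill; rewrite //=; lia.
case: (n =P 9) => [def_n | n_neq9].
  by subst n; apply: (lower 6 (nth 0 [:: 0; 1; 2; 0; 1; 2; 3; 4; 5])).
(* The core for even lengths, lengthened by the three colours 0, 0, 1. *)
apply: (lower 6 (fill [:: 2; 3; 1; 0; 4; 5; 0; 1; 0; 0; 1])).
by apply: cycle_valid_fill; rewrite //=; lia.
Qed.

Theorem mainTheorem2 :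
  (forall n : nat, EC (star n) = n) /\
  (forall n : nat, 1 <= n ->
     EC (path_graph n) =
       if n <= 5 then n - 1
       else if n == 6 then 4
       else if n <= 10 then 5
       else 6) /\
  (forall n : nat, 3 <= n ->
     EC (cycle_graph n) =
       if n <= 6 then n
       else if n == 7 then 5
       else 6) /\
  (forall p q : nat, q <= p -> EC (double_star p q) = p + q + 1).
Proof.
split; first exact: EC_star; split.
  by case=> // m _; rewrite EC_path subn1.
by split=> [|p q _]; [apply: EC_cycle | apply: EC_double_star].
Qed.
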